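(* Let $k\ge 2$, let $(X_i,d_i)$, $1\le i\le k$, be compact metric spaces with continuous maps $T_i:X_i\to X_i$, and let $\pi_i:X_i\to X_{i+1}$ $(1\le i\le k-1)$ be factor maps, i.e. continuous maps with $\pi_i\circ T_i=T_{i+1}\circ\pi_i$. Let $\mathbf a=(a_1,\dots,a_k)\in\mathbb R^k$ with $a_1>0$ and $a_i\ge 0$ for $2\le i\le k$. If the $\mathbf a$-weighted topological entropy $h^{\mathbf a}(X_1)$ is finite, then the $\mathbf a$-weighted mean dimension vanishes: $\mathrm{mdim}^{\mathbf a}(X_1,T_1)=0$.
   Context: Notation: $\pi_0=\mathrm{id}_{X_1}$ and $\tau_i=\pi_i\circ\pi_{i-1}\circ\cdots\circ\pi_0:X_1\to X_{i+1}$ for $0\le i\le k-1$. $\lceil u\rceil$ is the least integer $\ge u$. Covers: for finite open covers $\alpha,\beta$ of a compact metric space $X$, $\beta\succ\alpha$ ($\beta$ refines $\alpha$) means every member of $\beta$ is contained in some member of $\alpha$; $\alpha\vee\beta=\{U\cap V:U\in\alpha,V\in\beta\}$; for a continuous map $f$, $f^{-1}\alpha=\{f^{-1}(U):U\in\alpha\}$. Put $\mathrm{ord}(\alpha)=\max_{x\in X}\sum_{U\in\alpha}1_U(x)-1$ and $D(\alpha)=\min_{\beta\succ\alpha}\mathrm{ord}(\beta)$, where $\beta$ runs over all finite open covers of $X$ refining $\alpha$. Weighted mean dimension: $$\mathrm{mdim}^{\mathbf a}(X_1,T_1)=\sup_{\alpha_1,\dots,\alpha_k}\limsup_{n\to\infty}\frac1n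 D\Big(\bigvee_{i=1}^{k}\ \bigvee_{j=0}^{\lceil(a_1+\cdots+a_i)n\rceil-1}T_1^{-j}\tau_{i-1}^{-1}\alpha_i\Big),$$ where $\alpha_i$ runs over all finite open covers of $X_i$, $1\le i\le k$. Weighted topological entropy: for $n\in\mathbb N$ (positive integers) define the metric $$d_n^{\mathbf a}(x,y)=\sup\{d_i(T_i^j\tau_{i-1}x,T_i^j\tau_{i-1}y):1\le i\le k,\ 0\le j\le\lceil(a_1+\cdots+a_i)n\rceil-1\}$$ on $X_1$. A set $F\subset X_1$ is $(\mathbf a,n,\epsilon)$-spanning if for every $x\in X_1$ there is $y\in F$ with $d_n^{\mathbf a}(x,y)\le\epsilon$; $r_n^{\mathbf a}(X_1,\epsilon)$ is the smallest cardinality of an $(\mathbf a,n,\epsilon)$-spanning set. Then $$h^{\mathbf a}(X_1)=\lim_{\epsilon\to0}\limsup_{n\to\infty}\frac1n\log r_n^{\mathbf a}(X_1,\epsilon)\in[0,\infty].$$ *)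

(* Defs.v *)
From mathcomp Require Import all_boot all_order all_algebra.
From mathcomp Require Import finmap.
From mathcomp Require Import all_classical all_reals all_analysis.

Set Implicit Arguments.
Unset Strict Implicit.
Unset Printing Implicit Defensive.

Import Order.TTheory GRing.Theory Num.Theory.

Local Open Scope classical_set_scope.
Local Open Scope ring_scope.

(* Indices start at 0 throughout: the space X i, the map T i, the distance on
   X i, the weight a i and the cover alpha i carry the index i + 1 in the
   mathematical notation, and pi i : X i -> X i.+1 is pi_{i+1}. A system of k
   spaces is given by families indexed by nat, which lets the maps pi i be
   composed without casts between dependent types; nothing below looks at
   indices i >= k. *)

Definition finite_open_cover (X : topologicalType) (alpha : set (set X)) :=
  [/\ finite_set alpha, (forall U, alpha U -> open U)
    & \bigcup_(U in alpha) U = setT].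

Definition refines (X : Type) (beta alpha : set (set X)) :=
  forall V, beta V -> exists2 U, alpha U & V `<=` U.

Definition cover_join (X : Type) (alpha beta : set (set X)) : set (set X) :=
  [set U `&` V | U in alpha & V in beta].

Definition cover_preimage (X Y : Type) (f : X -> Y) (alpha : set (set Y)) :
  set (set X) := [set f @^-1` U | U in alpha].

(* The real supremum is a maximum (finitely many integer values), except on an
   empty X, where it is 0. *)
Definition cover_ord (R : realType) (X : Type) (alpha : set (set X)) : R :=
  sup [set (\sum_(U \in alpha) (\1_U x : R)) - 1 | x in [set: X]].

(* A minimum, since the values of cover_ord are natural numbers. *)
Definition cover_D (R : realType) (X : topologicalType)
    (alpha : set (set X)) : R :=
  inf [set cover_ord R beta | beta in
        [set beta : set (set X) | finite_open_cover beta /\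
                                  refines beta alpha]].

Fixpoint tau (X : nat -> Type) (pi : forall i, X i -> X i.+1) (i : nat) :
    X 0%N -> X i :=
  if i is j.+1 then fun x => pi j (tau pi j x) else id.

Definition horizon (R : realType) (k : nat) (a : 'I_k -> R) (i : 'I_k)
    (n : nat) : nat :=
  `|Num.ceil ((\sum_(l < k | (l <= i)%N) a l) * n%:R)|%N.

(* [set setT] is neutral for cover_join. *)
Definition weighted_join (R : realType) (X : nat -> metricType R)
    (T : forall i, X i -> X i) (pi : forall i, X i -> X i.+1)
    (k : nat) (a : 'I_k -> R)
    (alpha : forall i : 'I_k, set (set (X i))) (n : nat) :
    set (set (X 0%N)) :=
  \big[@cover_join (X 0%N)/[set setT]]_(i < k)
    \big[@cover_join (X 0%N)/[set setT]]_(j < horizon a i n)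
      cover_preimage (iter j (T 0%N)) (cover_preimage (tau pi i) (alpha i)).

(* In both limits superior below, the term n = 0 is irrelevant. *)
Definition weighted_mdim (R : realType) (X : nat -> metricType R)
    (T : forall i, X i -> X i) (pi : forall i, X i -> X i.+1)
    (k : nat) (a : 'I_k -> R) : \bar R :=
  ereal_sup
    [set limn_esup (fun n : nat =>
           (n%:R^-1 * cover_D R (weighted_join T pi a alpha n))%:E)
    | alpha in [set alpha : forall i : 'I_k, set (set (X i)) |
                 forall i, finite_open_cover (alpha i)]].

Definition weighted_dist (R : realType) (X : nat -> metricType R)
    (T : forall i, X i -> X i) (pi : forall i, X i -> X i.+1)
    (k : nat) (a : 'I_k -> R) (n : nat) (x y : X 0%N) : R :=
  sup [set r | exists (i : 'I_k) (j : 'I_(horizon a i n)),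
         r = mdist (iter j (T i) (tau pi i x)) (iter j (T i) (tau pi i y))].

Definition spanning (R : realType) (X : nat -> metricType R)
    (T : forall i, X i -> X i) (pi : forall i, X i -> X i.+1)
    (k : nat) (a : 'I_k -> R) (n : nat) (eps : R) (F : set (X 0%N)) :=
  forall x, exists2 y, F y & weighted_dist T pi a n x y <= eps.

Definition span_number (R : realType) (X : nat -> metricType R)
    (T : forall i, X i -> X i) (pi : forall i, X i -> X i.+1)
    (k : nat) (a : 'I_k -> R) (n : nat) (eps : R) : \bar R :=
  ereal_inf [set (#|` F|%:R)%:E | F in
              [set F : {fset X 0%N} | spanning T pi a n eps [set` F]]].

(* The limit exists in \bar R: the limit superior is nonincreasing in eps. *)
Definition weighted_entropy (R : realType) (X : nat -> metricType R)
    (T : forall i, X i -> X i) (pi : forall i, X i -> X i.+1)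
    (k : nat) (a : 'I_k -> R) : \bar R :=
  lim (limn_esup (fun n : nat =>
         ((n%:R^-1)%:E * lne (span_number T pi a n eps))%E)
       @[eps --> (0 : R)^'+]).

(* Main.v *)
Require Import Defs.
From mathcomp Require Import all_boot all_order all_algebra.
From mathcomp Require Import finmap.
From mathcomp Require Import all_classical all_reals all_analysis.
From mathcomp Require Import ring lra.

(* Separate the covers alpha_i by finitely many Lipschitz functions
   u : X_i -> [0,1], and let f_j, for j in a set J of size O(n), be all the
   functions u o T_i^t o tau_i involved at time n: a nonempty open set on which
   every f_j is either < 1 throughout or > 0 throughout lies in a member of the
   join.  If xi in [0,1]^J is such that every point x satisfies f_j x = xi_j for
   at most m indices j, then such open sets, indexed by the set of those j for
   which f_j is closest to xi_j and by the signs of the other f_j - xi_j, cover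
   X_1 with order at most m.  Finite entropy provides a spanning set of size
   e^{O(n)} at any fixed scale, and counting then shows that some xi in a
   sufficiently fine, but fixed, grid works with m <= n / q. *)

Set Implicit Arguments.
Unset Strict Implicit.
Unset Printing Implicit Defensive.

Import Order.TTheory GRing.Theory Num.Theory.
Import numFieldNormedType.Exports.

Local Open Scope classical_set_scope.
Local Open Scope ring_scope.

(** * Open sets cut out by finitely many strict inequalities *)

Lemma open_forall_fin (X : topologicalType) (I : finType) (P : I -> set X) :
  (forall i, open (P i)) -> open [set x | forall i, P i x].
Proof.
move=> oP; rewrite openE => x Px; apply: filter_forall => i.
by have := oP i; rewrite openE; apply.
Qed.

Lemma open_imply (X : topologicalType) (b : Prop) (P : set X) :
  open P -> open [set x | b -> P x].
Proof.
move=> oP; have [hb|nb] := pselect b.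
  by have -> : [set x | b -> P x] = P by apply/seteqP; split=> [x /(_ hb)|x Px _].
have -> : [set x | b -> P x] = setT by apply/seteqP; split=> // x _ /nb.
exact: openT.
Qed.

Lemma open_ltr_fun (R : realType) (X : topologicalType) (f g : X -> R) :
  continuous f -> continuous g -> open [set x | f x < g x].
Proof.
move=> cf cg; have -> : [set x | f x < g x] =
    (fun x => g x - f x) @^-1` [set y | 0 < y].
  by apply/seteqP; split=> x /=; rewrite subr_gt0.
apply: open_comp; last exact: open_gt.
by move=> x _; apply: cvgB; [exact: cg | exact: cf].
Qed.

(** * Bounds on the order of a cover and on [cover_D] *)

Section cover_order.
Variable R : realType.

(** The members through a common point have pairwise distinct levels in 0, ..., m, so there are at
    most m + 1 of them. *)
Lemma cover_ord_le (X : Type) (beta : set (set X)) (m : nat)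
    (lev : set X -> nat) :
    finite_set beta -> (forall U, beta U -> (lev U <= m)%N) ->
    (forall U V, beta U -> beta V -> lev U = lev V -> U `&` V !=set0 ->
      U = V) ->
  cover_ord R beta <= m%:R.
Proof.
move=> fb levm levinj; rewrite /cover_ord; set S := [set _ | _ in _].
have [->|/set0P S0] := eqVneq S set0; first by rewrite sup0.
apply: ge_sup => // _ [x _ <-].
rewrite lerBlDr natr1 fsbig_finite//=.
under eq_bigr do rewrite indicE.
rewrite -natr_sum ler_nat.
pose s := [seq U <- fset_set beta | x \in U].
have -> : (\sum_(U <- fset_set beta) (x \in U) = size s)%N.
  rewrite size_filter -sum1_count [RHS]big_mkcond/=.
  by apply: eq_bigr => U _; case: (x \in U).
rewrite -(size_map lev) -(size_iota 0 m.+1); apply: uniq_leq_size.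
  rewrite map_inj_in_uniq ?filter_uniq ?fset_uniq//.
  move=> U V; rewrite !mem_filter !in_fset_set// => /andP[/set_mem xU].
  move=> /set_mem bU /andP[/set_mem xV /set_mem bV] UV.
  by apply: levinj => //; exists x.
move=> _ /mapP[U + ->]; rewrite mem_filter in_fset_set// => /andP[_].
by move=> /set_mem/levm; rewrite mem_iota.
Qed.

Lemma cover_ord_ge0 (X : topologicalType) (beta : set (set X)) :
  finite_open_cover beta -> 0 <= cover_ord R beta.
Proof.
move=> [fb _ cb]; rewrite /cover_ord; set S := [set _ | _ in _].
(* Without a supremum, [sup] is 0 by default; otherwise it dominates the value at any one point,
   where some member of the cover contributes 1. *)
have [[[r Sr] hub]|/sup_out->//] := pselect (has_sup S).
apply: le_trans (ub_le_sup hub Sr).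
case: Sr => x _ <-; rewrite subr_ge0.
have [U bU Ux] : (\bigcup_(U in beta) U) x by rewrite cb.
rewrite (fsbigD1 U)//=.
rewrite indicE mem_set// lerDl; apply: fsumr_ge0 => V _.
by rewrite indicE.
Qed.

Lemma cover_D_ge0 (X : topologicalType) (alpha : set (set X)) :
  0 <= cover_D R alpha.
Proof.
rewrite /cover_D; set S := [set _ | _ in _].
have [->|/set0P S0] := eqVneq S set0; first by rewrite inf0.
by apply: lb_le_inf => // _ [b [fb _] <-]; exact: cover_ord_ge0.
Qed.

Lemma cover_D_le (X : topologicalType) (alpha beta : set (set X)) :
  finite_open_cover beta -> refines beta alpha ->
  cover_D R alpha <= cover_ord R beta.
Proof.
move=> fb rb; apply: ge_inf; last by exists beta.
by exists 0 => _ [b [fb' _] <-]; exact: cover_ord_ge0.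
Qed.
End cover_order.

(** * Covers of small order by level cells *)

Section level_cover.
Variables (R : realType) (X : topologicalType) (J : finType).
Variables (f : J -> X -> R) (xi : J -> R).
Let g j x := f j x - xi j.

(* Cells with the same #|s.1| are equal or disjoint, since s.1 is the set of the
   #|s.1| indices where f is closest to xi: each point meets at most one cell per
   level. *)
Definition level_cell (s : {set J} * {set J}) : set X :=
  [set x | [/\ forall i, i \in s.1 -> `|g i x| < 2^-1,
    forall i j, i \in s.1 -> j \notin s.1 -> `|g i x| < `|g j x| &
    forall j, j \notin s.1 -> if j \in s.2 then 0 < g j x else g j x < 0]].

(** Empty cells are dropped because the refinement argument later picks a point in each member. *)
Definition level_cover (m : nat) : set (set X) :=
  [set V | exists s, [/\ V = level_cell s, (#|s.1| <= m)%N & V !=set0]].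

Hypothesis cf : forall j, continuous (f j).

Lemma level_cell_open s : open (level_cell s).
Proof.
have cg j : continuous (g j).
  by move=> x; apply: cvgB; [exact: cf | exact: cvg_cst].
have cn j : continuous (fun x => `|g j x|).
  by move=> x; apply: cvg_norm; exact: cg.
have cc (c : R) : continuous (fun _ : X => c) by move=> x; exact: cvg_cst.
have -> : level_cell s = [set x | forall i, i \in s.1 -> `|g i x| < 2^-1] `&`
  [set x | forall i j, i \in s.1 -> j \notin s.1 -> `|g i x| < `|g j x|] `&`
  [set x | forall j, j \notin s.1 -> if j \in s.2 then 0 < g j x else g j x < 0].
  by apply/seteqP; split=> [x [? ? ?]|x [[? ?] ?]].
apply: openI; first apply: openI.
- by apply: open_forall_fin => i; apply: open_imply; exact: open_ltr_fun.
- apply: open_forall_fin => i; apply: open_forall_fin => j.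
  by do 2 apply: open_imply; exact: open_ltr_fun.
- apply: open_forall_fin => j; apply: open_imply.
  by case: (j \in s.2); exact: open_ltr_fun.
Qed.

Lemma level_cell_eq (s s' : {set J} * {set J}) : #|s.1| = #|s'.1| ->
  level_cell s `&` level_cell s' !=set0 -> level_cell s = level_cell s'.
Proof.
case: s s' => [Z P] [Z' P']/= ZZ' [x [[/= _ lt1 sg1] [/= _ lt2 sg2]]].
have eZ : Z = Z'.
  apply/eqP; rewrite eqEcard ZZ' leqnn andbT; apply/fintype.subsetP => i iZ.
  apply/negPn/negP => iZ'.
  (* If Z and Z' differed, equal size would give such a j, and each of i and j would be strictly
     closer to [xi] than the other. *)
  have /fintype.subsetPn[j jZ' jZ] : ~~ (Z' \subset Z).
    apply/negP => sub; have /eqP ZE : Z' == Z by rewrite eqEcard sub ZZ' /=.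
    by rewrite ZE iZ in iZ'.
  by have := lt_trans (lt1 _ _ iZ jZ) (lt2 _ _ jZ' iZ'); rewrite ltxx.
(* The sign sets P and P' may still differ, but only inside Z, where cells ignore them. *)
subst Z'; have eP j : j \notin Z -> (j \in P) = (j \in P').
  move=> jZ; have := sg1 _ jZ; have := sg2 _ jZ.
  by case: ifP; case: ifP => // _ _ /lt_trans/[apply]; rewrite ltxx.
apply/seteqP; split=> y [/= h1 h2 h3]; split=> //= j jZ; have := h3 _ jZ.
  by rewrite eP.
by rewrite -eP.
Qed.

Variable m : nat.
Hypothesis few : forall x, (#|[set j | f j x == xi j]%SET| <= m)%N.

Lemma level_cover_cover : finite_open_cover (level_cover m).
Proof.
split.
- apply: (@sub_finite_set _ _ (level_cell @` setT)).
    by move=> V [s [-> _ _]]; exists s.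
  by apply: finite_image; exact: finite_finset.
- by move=> _ [s [-> _ _]]; exact: level_cell_open.
- apply/seteqP; split=> // x _.
  (* The differences [g j x] vanish exactly on Z, which gives both inequalities of [level_cell];
     [few] bounds the size of Z. *)
  pose Z := [set j | f j x == xi j]%SET.
  pose s := (Z, [set j | 0 < g j x]%SET).
  have sx : level_cell s x.
    split=> [i|i j|j]; rewrite !inE /g.
    + by move=> /eqP->; rewrite subrr normr0 invr_gt0.
    + by move=> /eqP->; rewrite subrr normr0 normr_gt0 subr_eq0.
    + by move=> ne; case: ltgtP => // /eqP; rewrite eq_sym subr_eq0 (negbTE ne).
  by exists (level_cell s) => //; exists s; split=> //; [exact: few | exists x].
Qed.

Lemma level_cover_ord : cover_ord R (level_cover m) <= m%:R.
Proof.
(* Different index pairs can give the same cell, so the level, a function of the set alone, is read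
   off from a chosen pair. *)
pose pick V := if pselect (level_cover m V) is left h then (projT1 (cid h))
  else (finset.set0, finset.set0).
have pickP V : level_cover m V ->
    V = level_cell (pick V) /\ (#|(pick V).1| <= m)%N.
  by rewrite /pick; case: pselect => // h _; case: cid => /= s [].
apply: (@cover_ord_le _ _ _ _ (fun V => #|(pick V).1|)).
- by have [] := level_cover_cover.
- by move=> V /pickP[].
- move=> U V /pickP[UE _] /pickP[VE _] eUV UV0.
  by rewrite UE VE; apply: level_cell_eq => //; rewrite -UE -VE.
Qed.

Hypothesis xi01 : forall j, 0 <= xi j <= 1.

(** For j in [s.1] the values stay within 1/2 of [xi j], hence below 1 if [xi j] is at most 1/2 and
    above 0 otherwise. For the other j they stay strictly on one side of [xi j], which lies in
    [0,1]. *)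
Lemma level_cover_refine V j : level_cover m V ->
  V `<=` [set x | f j x < 1] \/ V `<=` [set x | 0 < f j x].
Proof.
move=> [s [-> _ _]]; have /andP[x0 x1] := xi01 j.
have [js|js] := boolP (j \in s.1).
  have [xh|xh] := lerP (xi j) 2^-1; [left|right] => x [/(_ _ js) + _ _] /=;
  rewrite /g ltr_norml => /andP[]; lra.
have [jP|jP] := boolP (j \in s.2); [right|left] => x [_ _ /(_ _ js)] /=;
  rewrite ?jP ?(negbTE jP) /g; lra.
Qed.

End level_cover.

(** * Counting grid points that rarely agree with given ones *)

(** There is one choice at each index of S and M choices elsewhere; the product form avoids a
    subtraction in the exponent. *)
Lemma card_ffun_agree (J : finType) (M : nat) (q : {ffun J -> 'I_M})
    (S : {set J}) :
  (#|[set p : {ffun J -> 'I_M} | [forall j in S, p j == q j]]%SET| * M ^ #|S|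
    = M ^ #|J|)%N.
Proof.
have -> : #|[set p : {ffun J -> 'I_M} | [forall j in S, p j == q j]]%SET| =
    #|family (fun j => if j \in S then pred1 (q j) else predT)|.
  apply: eq_card => p; rewrite inE; apply/forallP/familyP => h j.
    by have := h j; case: (j \in S) => //=; rewrite inE.
  by have := h j; case: (j \in S) => //=; rewrite inE.
rewrite card_family foldrE big_map big_enum/=.
rewrite -(prod_nat_const (mem S) M) -(prod_nat_const (mem J) M).
rewrite [X in (_ * X)%N]big_mkcond.
rewrite -big_split/=.
by apply: eq_bigr => j _; case: (j \in S); rewrite ?card1 ?mul1n ?muln1 ?card_ord.
Qed.

(** A union bound: if every p agreed with some q in G on some set of m + 1 indices, the M^|J|
    functions would be covered by at most |G| 2^|J| sets of M^(|J| - m - 1) elements each. *)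
Lemma exists_rarely_agreeing (J : finType) (M m : nat)
    (G : seq {ffun J -> 'I_M}) :
    (size G * 2 ^ #|J| < M ^ m.+1)%N ->
  exists p : {ffun J -> 'I_M},
    forall q, q \in G -> (#|[set j | p j == q j]%SET| <= m)%N.
Proof.
move=> lt; apply: contrapT => none; move: lt; apply/negP; rewrite -leqNgt.
have [M0|M0] := posnP M; first by rewrite [X in (X ^ _)%N]M0 exp0n.
pose B (q : {ffun J -> 'I_M}) (S : {set J}) :=
  [set p : {ffun J -> 'I_M} | [forall j in S, p j == q j]]%SET.
have bad p : (1 <= \sum_(q <- G) \sum_(S : {set J} | #|S| == m.+1)
    (p \in B q S))%N.
  have [q qG mq] : exists2 q, q \in G &
      (m < #|[set j | p j == q j]%SET|)%N.
    apply: contrapT => nq; apply: none; exists p => q qG; rewrite leqNgt.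
    by apply/negP => mq; apply: nq; exists q.
  have [s [us sz sS]] := card_geqP mq.
  rewrite (big_rem q)//= (bigD1 [set j in s]%SET)/=; last first.
    by rewrite cardsE (card_uniqP us) sz.
  rewrite (_ : p \in _)//; rewrite inE; apply/forallP => j; apply/implyP.
  by rewrite inE => /sS; rewrite inE.
have {}bad : (M ^ #|J| <=
    \sum_(q <- G) \sum_(S : {set J} | #|S| == m.+1) #|B q S|)%N.
  rewrite -{1}(card_ord M) -card_ffun -sum1_card.
  apply: (@leq_trans (\sum_(p : {ffun J -> 'I_M}) \sum_(q <- G)
      \sum_(S : {set J} | #|S| == m.+1) (p \in B q S))%N).
    by apply: leq_sum => p _; exact: bad.
  rewrite exchange_big/=; apply: leq_sum => q _.
  rewrite exchange_big/=; apply: leq_sum => S _.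
  by rewrite -sum1_card [leqRHS]big_mkcond/=; apply: leq_sum => p _; case: ifP.
(* Both sides are multiplied by M^|J| so that, after [bad], [card_ffun_agree] evaluates each
   term. *)
rewrite -(@leq_pmul2r (M ^ #|J|)) ?expn_gt0 ?M0// mulnC.
apply: leq_trans (leq_mul bad (leqnn _)) _.
rewrite big_distrl/= -mulnA -sum1_size big_distrl/=; apply: leq_sum => q _.
(* The subsets of size m + 1 are crudely counted by the whole power set. *)
rewrite mul1n big_distrl/= -cardsT -card_powerset -sum1_card big_distrl/=.
rewrite [leqLHS]big_mkcond [leqRHS]big_mkcond/=; apply: leq_sum => S _.
rewrite powersetT inE; case: eqP => // <-.
by rewrite card_ffun_agree mul1n cardsT.
Qed.

(** The values of the f_j at the points of F are rounded to multiples of 1/(M+1), and xi is a grid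
    point that rarely agrees with these roundings. If f_j x = xi_j and c in F is close to x, then
    f_j c rounds to xi_j; so this happens for at most m indices j. *)
Lemma exists_small_cover (R : realType) (X : topologicalType) (J : finType)
    (f : J -> X -> R) (F : seq X) (M m : nat) :
    (forall j, continuous (f j)) ->
    (forall x, exists2 c, c \in F &
      forall j, `|f j x - f j c| < (2 * M.+1%:R)^-1) ->
    (size F * 2 ^ #|J| < M.+1 ^ m.+1)%N ->
  exists beta : set (set X), [/\ finite_open_cover beta,
    cover_ord R beta <= m%:R &
    forall V, beta V -> V !=set0 /\ forall j,
      V `<=` [set x | f j x < 1] \/ V `<=` [set x | 0 < f j x]].
Proof.
(* Half the mesh of the grid: two grid values at distance less than e from the same number
   coincide. *)
move=> cf nearF szF; pose e : R := (2 * M.+1%:R)^-1.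
have M0 : 0 < M.+1%:R :> R by rewrite ltr0n.
have e2 : e + e = M.+1%:R^-1.
  by rewrite /e invfM; field; rewrite gt_eqF.
pose grid (p : 'I_M.+1) : R := p%:R / M.+1%:R.
have gridI p p' : `|grid p - grid p'| < M.+1%:R^-1 -> p = p'.
  rewrite /grid -mulrBl normrM (ger0_norm (x := _^-1)) ?invr_ge0 ?ltW//.
  rewrite -[ltRHS]mul1r ltr_pM2r ?invr_gt0// => lt1.
  apply/val_inj/eqP; rewrite eqn_leq /=; apply/andP; split.
    by rewrite -ltnS -(ltr_nat R) -natr1; move: lt1; rewrite ltr_norml; lra.
  by rewrite -ltnS -(ltr_nat R) -natr1; move: lt1; rewrite ltr_norml; lra.
(* The default [ord0] is used only when no grid value is within e of f_j c; then no x close to c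
   satisfies f_j x = xi_j. *)
pose q c : {ffun J -> 'I_M.+1} :=
  [ffun j => odflt ord0 [pick p | `|f j c - grid p| < e]].
have [|p pF] := @exists_rarely_agreeing J M.+1 m (map q F).
  by rewrite size_map.
have few x : (#|[set j | f j x == grid (p j)]%SET| <= m)%N.
  have [c cF xc] := nearF x; apply: leq_trans (pF (q c) (map_f _ cF)).
  apply/subset_leq_card/fintype.subsetP => j; rewrite !inE => /eqP fx.
  rewrite ffunE; case: pickP => [p' /= cp'|/(_ (p j))/=]; last first.
    by rewrite -fx distrC xc.
  apply/eqP/gridI; rewrite -fx -e2 (le_lt_trans (ler_distD (f j c) _ _))//.
  by rewrite ltrD// xc.
have grid01 j : 0 <= grid (p j) <= 1.
  rewrite /grid divr_ge0 ?ler0n//= ler_pdivrMr// mul1r ler_nat.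
  by rewrite ltnW.
exists (level_cover f (fun j => grid (p j)) m); split.
- exact: level_cover_cover.
- exact: level_cover_ord.
- move=> V bV; split; first by case: bV => s [].
  by move=> j; exact: (level_cover_refine grid01 j bV).
Qed.

(** * Lebesgue numbers and Lipschitz bump functions *)

Lemma lebesgue_number (R : realType) (X : metricType R) (alpha : set (set X)) :
    compact [set: X] -> finite_open_cover alpha ->
  exists2 l : R, 0 < l & forall x, exists2 U, alpha U & ball x l `<=` U.
Proof.
move=> /compact_near_coveringP cX [_ oa ca].
have /= := cX R (0^'+) (fun r x => exists2 U, alpha U & ball x r `<=` U) _.
case=> [x _|].
  have [U aU Ux] : (\bigcup_(U in alpha) U) x by rewrite ca.
  have := oa U aU; rewrite openE => /(_ x Ux).
  rewrite /interior -nbhs_ballE => -[r /= r0 rU].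
  (* A ball of radius s < r/2 around a point of [ball x (r / 2)] stays inside [ball x r]. *)
  exists (ball x (r / 2), [set s | s < r / 2]).
    split=> /=; first by apply: nbhsx_ballx; rewrite divr_gt0.
    by apply: nbhs_right_lt; rewrite divr_gt0.
  move=> [y s] /= [xy sr]; exists U => //; apply: subset_trans rU => z yz.
  rewrite (splitr r); apply: ball_triangle xy _.
  exact: le_ball (ltW sr) _ yz.
move=> e /= e0 he; exists (e / 2); first by rewrite divr_gt0.
move=> x; apply: (he (e / 2)) => //=; last by rewrite divr_gt0.
rewrite sub0r normrN gtr0_norm ?divr_gt0//; rewrite ltr_pdivrMr//; lra.
Qed.

(** Each function is the distance to the complement of a member, truncated at a Lebesgue number and
    divided by it. The value 1 is reached at every point because some member contains the whole
    ball; this will rule out the alternative u < 1 on a cell. *)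
Lemma cover_bump_functions (R : realType) (X : metricType R)
    (alpha : set (set X)) :
    compact [set: X] -> finite_open_cover alpha ->
  exists (s : nat) (u : 'I_s -> X -> R) (l : R), [/\ 0 < l,
    forall i x y, `|u i x - u i y| <= l * mdist x y,
    forall x, exists i, u i x = 1 &
    forall i, exists2 U, alpha U & [set x | 0 < u i x] `<=` U].
Proof.
move=> cX fa; have [l l0 lX] := lebesgue_number cX fa.
have [/finite_seqP[s sE] _ _] := fa.
pose W (i : 'I_(size s)) := nth setT s i.
(* The distance to the complement of W i, truncated at l; adding l to the set
   also avoids the infimum of the empty set when W i is everything. *)
pose E i x := l |` [set mdist x y | y in ~` W i].
have Eub i x : E i x l by left.
have Elb i x : lbound (E i x) 0.
  by move=> _ [->|[y _ <-]]; [exact: ltW | exact: mdist_ge0].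
have hE i x r : E i x r -> inf (E i x) <= r by apply: ge_inf; exists 0.
have lip1 i x y : inf (E i x) <= inf (E i y) + mdist x y.
  rewrite -lerBlDr; apply: lb_le_inf; first by exists l.
  move=> _ [->|[z Wz <-]]; rewrite lerBlDr.
    by apply: le_trans (hE _ _ _ (Eub i x)) _; rewrite lerDl mdist_ge0.
  apply: le_trans (hE _ _ (mdist x z) _) _; first by right; exists z.
  by rewrite addrC metric_triangle.
exists (size s), (fun i x => inf (E i x) / l), l^-1; split.
- by rewrite invr_gt0.
- move=> i x y; rewrite -mulrBl normrM mulrC gtr0_norm ?invr_gt0//.
  rewrite ler_pM2l ?invr_gt0// ler_norml; have := lip1 i x y.
  by have := lip1 i y x; rewrite (metric_sym y); lra.
- move=> x; have [U + xU] := lX x; rewrite sE /= => Us.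
  have iU : (index U s < size s)%N by rewrite index_mem.
  exists (Ordinal iU); suff -> : inf (E (Ordinal iU) x) = l.
    by rewrite divff// gt_eqF.
  apply/eqP; rewrite eq_le hE//=.
  apply: lb_le_inf; first by exists l.
  move=> _ [->//|[y /= + <-]]; rewrite /W /= nth_index// => Uy.
  rewrite leNgt; apply/negP => xy; apply/Uy/xU.
  by rewrite ballEmdist.
- move=> i; exists (W i); first by rewrite sE/= mem_nth.
  move=> x /=; rewrite pmulr_lgt0 ?invr_gt0// => E0; apply: contrapT => Wx.
  suff : inf (E i x) <= 0 by rewrite leNgt E0.
  by apply: hE; right; exists x => //; rewrite mdistxx.
Qed.

(** * Bounds on limits superior *)

Section limn_esup_bounds.
Variable R : realType.
Implicit Types u v : (\bar R)^nat.
Local Open Scope ereal_scope.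

(** The limit superior is the infimum, over sets V in the filter at infinity, of the supremum of u
    on V; the indices with u n <= l form such a V. *)
Lemma limn_esup_le_near u l : (\forall n \near \oo, u n <= l) ->
  limn_esup u <= l.
Proof.
move=> ul; apply: (@le_trans _ _ (ereal_sup (u @` [set n | u n <= l]))).
  by apply: ereal_inf_lbound; exists [set n | u n <= l].
by apply: ge_ereal_sup => _ [n ? <-].
Qed.

Lemma limn_esup_ge0 u : (forall n, 0 <= u n) -> 0 <= limn_esup u.
Proof.
move=> u0; apply: le_ereal_inf_tmp => _ [V FV <-].
have [n Vn] := filter_ex FV.
by apply: le_trans (u0 n) _; apply: ereal_sup_ubound; exists n.
Qed.

Lemma limn_esup_mono u v : (forall n, u n <= v n) ->
  limn_esup u <= limn_esup v.
Proof.
move=> uv; apply: le_ereal_inf_tmp => _ [V FV <-].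
apply: (@le_trans _ _ (ereal_sup (u @` V))).
  by apply: ereal_inf_lbound; exists V.
apply: ge_ereal_sup => _ [n Vn <-]; apply: le_trans (uv n) _.
by apply: ereal_sup_ubound; exists n.
Qed.

Lemma limn_esup_lt_near u l : limn_esup u < l -> \forall n \near \oo, u n < l.
Proof.
move=> /ereal_inf_lt[_ [V FV <-] Vl]; apply: filterS FV => n Vn.
by apply: le_lt_trans Vl; apply: ereal_sup_ubound; exists n.
Qed.

End limn_esup_bounds.

(** * Lipschitz functions and refinement of iterated joins *)

Lemma lipschitz_continuous (R : realType) (X : metricType R) (u : X -> R)
    (l : R) : 0 < l -> (forall x y, `|u x - u y| <= l * mdist x y) ->
  continuous u.
Proof.
move=> l0 lip x; apply/cvgrPdist_lt => e e0.
apply/nbhs_ballP; exists (e / l); first by rewrite /= divr_gt0.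
move=> y; rewrite ballEmdist/= => xy; apply: le_lt_trans (lip _ _) _.
by rewrite mulrC -ltr_pdivlMr.
Qed.

Lemma cover_join_refines (X : Type) (I : finType) (C : I -> set (set X))
    (V : set X) :
  (forall i, exists2 U, C i U & V `<=` U) ->
  exists2 U, (\big[@cover_join X/[set setT]]_i C i) U & V `<=` U.
Proof.
move=> CV; apply: (big_ind (fun D => exists2 U, D U & V `<=` U)) => //.
- by exists setT.
- move=> D D' [U DU VU] [U' DU' VU']; exists (U `&` U').
    by exists U => //; exists U'.
  by move=> x Vx; split; [exact: VU | exact: VU'].
Qed.

(** * Factor maps, the weighted metric and spanning sets *)

Section factor_chain.
Variables (R : realType) (k : nat) (X : nat -> metricType R).
Variables (T : forall i, X i -> X i) (pi : forall i, X i -> X i.+1).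
Variable a : 'I_k -> R.
Arguments T : clear implicits.
Arguments pi : clear implicits.

(** The join pulls covers back by [tau] after iterates of [T 0], while the weighted metric iterates
    [T i] after [tau]; this reconciles the two. *)
Lemma tau_iter :
    (forall i, (i.+1 < k)%N -> pi i \o T i = T i.+1 \o pi i) ->
  forall i j x, (i < k)%N ->
    tau pi i (iter j (T 0%N) x) = iter j (T i) (tau pi i x).
Proof.
move=> piT i j x; elim: i => [//|i IH] ik /=.
rewrite (IH (ltnW ik)); elim: j {IH} => [//|j /= <-].
exact: (congr1 (@^~ _) (piT i ik)).
Qed.

Lemma tau_continuous : (forall i, (i.+1 < k)%N -> continuous (pi i)) ->
  forall i, (i < k)%N -> continuous (tau pi i).
Proof.
move=> cpi; elim=> [_ x|i IH ik x]; first exact: cvg_id.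
by apply: continuous_comp; [exact: IH (ltnW ik) _ | exact: cpi].
Qed.

Lemma iter_continuous (Y : topologicalType) (g : Y -> Y) j :
  continuous g -> continuous (iter j g).
Proof.
move=> cg; elim: j => [x|j IH x]; first exact: cvg_id.
by apply: continuous_comp; [exact: IH | exact: cg].
Qed.

Lemma mdist_le_weighted_dist (n : nat) (i : 'I_k) (j : 'I_(horizon a i n))
    (x y : X 0%N) :
  mdist (iter j (T i) (tau pi i x)) (iter j (T i) (tau pi i y)) <=
  weighted_dist T pi a n x y.
Proof.
apply: ub_le_sup; last by exists i, j.
(* The real [sup] dominates its set only if that set is bounded above; the sum of the finitely many
   distances is a bound. *)
pose d (i : 'I_k) (j : 'I_(horizon a i n)) :=
  mdist (iter j (T i) (tau pi i x)) (iter j (T i) (tau pi i y)).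
have d0 i' j' : 0 <= d i' j' by exact: mdist_ge0.
exists (\sum_i' \sum_j' d i' j') => _ [i' [j' ->]].
rewrite (bigD1 i')//= (bigD1 j')//= -addrA lerDl addr_ge0 ?sumr_ge0//.
by move=> i'' _; rewrite sumr_ge0.
Qed.

(** The right-hand side is an integer at least A n, hence at least its ceiling. This keeps the
    number of functions at time n below a fixed multiple of n. *)
Lemma horizon_le (n : nat) (i : 'I_k) : (forall l, 0 <= a l) ->
  (horizon a i n <= `|Num.ceil (\sum_(l < k | (l <= i)%N) a l)|%N * n)%N.
Proof.
move=> a0; rewrite /horizon; set A := \sum_(l < k | _) _.
have A0 : 0 <= A by apply: sumr_ge0.
have c0 : 0 <= Num.ceil A by rewrite -(ler_int R) (le_trans A0)// ceil_ge.
have c1 : 0 <= Num.ceil (A * n%:R).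
  by rewrite -(ler_int R) (le_trans _ (ceil_ge _))// mulr_ge0.
rewrite -lez_nat PoszM !gez0_abs// ceil_le_int intrM.
by rewrite ler_wpM2r// ceil_ge.
Qed.

Lemma span_number_ge0 n eps : (0 <= span_number T pi a n eps)%E.
Proof. by apply: le_ereal_inf_tmp => _ [F _ <-]; rewrite lee_fin. Qed.

Lemma span_number_mono n eps eps' : eps <= eps' ->
  (span_number T pi a n eps' <= span_number T pi a n eps)%E.
Proof.
move=> ee; apply: ereal_inf_le_tmp => _ [F sF <-]; exists F => // x.
by have [y Fy xy] := sF x; exists y => //; exact: le_trans ee.
Qed.

Lemma spanning_lt n eps (r : R) : (0 < n)%N ->
    ((n%:R^-1)%:E * lne (span_number T pi a n eps) < r%:E)%E ->
  exists F : {fset X 0%N},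
    spanning T pi a n eps [set` F] /\ #|` F|%:R < expR (r * n%:R).
Proof.
move=> n0 ltr; suff : (span_number T pi a n eps < (expR (r * n%:R))%:E)%E.
  by move=> /ereal_inf_lt[_ [F sF <-]]; rewrite lte_fin; exists F.
have := span_number_ge0 n eps; move: ltr.
have n0R : 0 < n%:R^-1 :> R by rewrite invr_gt0 ltr0n.
(* An infinite spanning number would make the left side of [ltr] infinite; s = 0 is separated
   because the passage from [lne] to [ln] is made for s > 0. *)
case: (span_number _ _ _ _ _) => [s| |//]; last by rewrite /= gt0_muley.
rewrite lee_fin le_eqVlt => + /orP[/eqP<-|s0].
  by move=> _; rewrite lte_fin expR_gt0.
rewrite lne_EFin// -EFinM !lte_fin mulrC ltr_pdivrMr ?ltr0n// => ls.
by rewrite -(lnK (x := s)) ?posrE// ltr_expR.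
Qed.

(** The limit superior is nonincreasing in eps, so its limit at 0 is its supremum, and one h above
    the entropy serves at every scale. This uniformity allows the scale to be fixed after h. *)
Lemma spanning_of_finite_entropy : weighted_entropy T pi a \is a fin_num ->
  exists h : R, forall eps, 0 < eps -> \forall n \near \oo,
    exists F : {fset X 0%N},
      spanning T pi a n eps [set` F] /\ #|` F|%:R < expR (h * n%:R).
Proof.
move=> fe; pose g (eps : R) := limn_esup (fun n : nat =>
  ((n%:R^-1)%:E * lne (span_number T pi a n eps))%E).
have gmono : {in `]0, +oo[ &, {homo g : x y / x <= y >-> (y <= x)%E}}.
  move=> x y _ _ xy; apply: limn_esup_mono => n.
  rewrite lee_wpmul2l// ?lee_fin ?invr_ge0// lee_lne ?span_number_mono//.
    by rewrite in_itv/= span_number_ge0 leey.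
  by rewrite in_itv/= span_number_ge0 leey.
have := @nonincreasing_at_right_cvge R g 0 (BInfty _ false) isT gmono.
move=> /cvg_lim; rewrite -/(weighted_entropy T pi a) => /(_ _) supE.
exists (fine (weighted_entropy T pi a) + 1) => eps e0.
have : (g eps < (fine (weighted_entropy T pi a) + 1)%:E)%E.
  rewrite EFinD fineK//; apply: (@le_lt_trans _ _ (weighted_entropy T pi a)).
    rewrite supE//; apply: ereal_sup_ubound; exists eps => //=.
    by rewrite in_itv/= e0.
  by rewrite lteDl.
move=> /limn_esup_lt_near gn; near=> n; apply: spanning_lt; near: n => //.
Unshelve. all: by end_near.
Qed.

End factor_chain.

(** * Vanishing of the weighted mean dimension *)

Section mean_dimension.
Variables (R : realType) (k : nat) (X : nat -> metricType R).
Variables (T : forall i, X i -> X i) (pi : forall i, X i -> X i.+1).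
Variable a : 'I_k -> R.
Arguments T : clear implicits.
Arguments pi : clear implicits.
Hypothesis cX : forall i, (i < k)%N -> compact [set: X i].
Hypothesis cT : forall i, (i < k)%N -> continuous (T i).
Hypothesis cpi : forall i, (i.+1 < k)%N -> continuous (pi i).
Hypothesis piT : forall i, (i.+1 < k)%N -> pi i \o T i = T i.+1 \o pi i.
Hypothesis a0 : forall l, 0 <= a l.
Hypothesis fe : weighted_entropy T pi a \is a fin_num.

(** Since |J| <= K n and F has fewer than e^(h n) points, the count needed by [exists_small_cover]
    with m = n / q follows from (e^h 2^K)^n <= (M+1)^(m+1). This holds for M + 1 = B^q with B > e^h
    2^K. *)
Lemma cover_D_weighted_join_near (alpha : forall i : 'I_k, set (set (X i)))
    (q : nat) : (0 < q)%N -> (forall i, finite_open_cover (alpha i)) ->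
  \forall n \near \oo,
    cover_D R (weighted_join T pi a alpha n) <= (n %/ q)%:R.
Proof.
move=> q0 fa.
have bump (i : 'I_k) := cover_bump_functions (cX (ltn_ord i)) (fa i).
pose s i := projT1 (cid (bump i)).
pose u (i : 'I_k) : 'I_(s i) -> X i -> R :=
  projT1 (cid (projT2 (cid (bump i)))).
pose lam (i : 'I_k) : R := projT1 (cid (projT2 (cid (projT2 (cid (bump i)))))).
have uP i : [/\ 0 < lam i,
    forall l x y, `|u i l x - u i l y| <= lam i * mdist x y,
    forall x, exists l, u i l x = 1 &
    forall l, exists2 U, alpha i U & [set x | 0 < u i l x] `<=` U].
  exact: projT2 (cid (projT2 (cid (projT2 (cid (bump i)))))).
have [h hP] := spanning_of_finite_entropy fe.
pose H (i : 'I_k) := `|Num.ceil (\sum_(l < k | (l <= i)%N) a l)|%N.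
pose K := (\sum_i H i * s i)%N.
pose B := Num.bound (expR h * 2 ^+ K).
have hB : expR h * 2 ^+ K < B%:R.
  by apply: archi_boundP; rewrite mulr_ge0 ?expR_ge0 ?exprn_ge0.
have B0 : (0 < B)%N.
  by rewrite -(ltr0n R) (le_lt_trans _ hB)// mulr_ge0 ?expR_ge0 ?exprn_ge0.
pose M := (B ^ q).-1.
have ME : M.+1 = (B ^ q)%N by rewrite prednK// expn_gt0 B0.
(* L exceeds every Lipschitz constant strictly, so points at weighted distance at most e / L have
   values of each f_t differing by less than e. *)
pose L := 1 + \sum_i lam i.
have lam0 i : 0 < lam i by have [] := uP i.
have L0 : 0 < L by rewrite ltr_wpDr// sumr_ge0// => i _; exact: ltW.
have lamL i : lam i < L.
  rewrite /L (bigD1 i)//= addrCA ltrDl ltr_wpDr// sumr_ge0// => j _.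
  exact: ltW.
pose e : R := (2 * M.+1%:R)^-1.
have e0 : 0 < e by rewrite invr_gt0 mulr_gt0.
have := hP (e / L) (divr_gt0 e0 L0); apply: filterS => n [F [sF szF]].
(* An index consists of a space, a time below its horizon and a bump function on that space. *)
pose J := {i : 'I_k & ('I_(horizon a i n) * 'I_(s i))%type} : finType.
pose f (t : J) (x : X 0%N) : R := u (tag t) (tagged t).2
  (iter (tagged t).1 (T (tag t)) (tau pi (tag t) x)).
have cf t : continuous (f t).
  move=> x; apply: (@continuous_comp _ _ _ (tau pi (tag t))
    (u (tag t) (tagged t).2 \o iter (tagged t).1 (T (tag t)))).
    exact: (tau_continuous cpi (ltn_ord (tag t))).
  apply: continuous_comp.
    by apply: iter_continuous; exact: cT.
  by have [l0 lip _ _] := uP (tag t); exact: (lipschitz_continuous l0 (lip _)).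
have cardJ : (#|J| <= K * n)%N.
  rewrite card_tagged sumnE big_map big_enum/= big_distrl/=.
  apply: leq_sum => i _; rewrite card_prod !card_ord mulnAC leq_mul2r.
  by rewrite horizon_le// orbT.
have fF x : exists2 c, c \in enum_fset F & forall t, `|f t x - f t c| < e.
  have [c Fc xc] := sF x; exists c => // -[i [j l]]; rewrite /f /=.
  have [l0 lip _ _] := uP i; apply: le_lt_trans (lip _ _ _) _.
  apply: (@le_lt_trans _ _ (lam i * (e / L))).
    rewrite ler_pM2l//; apply: le_trans xc.
    exact: (@mdist_le_weighted_dist R k X T pi a n i j).
  by rewrite mulrCA gtr_pMr// ltr_pdivrMr// mul1r.
have szlt : (size (enum_fset F) * 2 ^ #|J| < M.+1 ^ (n %/ q).+1)%N.
  rewrite -(ltr_nat R) natrM.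
  apply: (@lt_le_trans _ _ (expR (h * n%:R) * 2 ^+ (K * n))).
    rewrite natrX; apply: (@lt_le_trans _ _ (expR (h * n%:R) * 2 ^+ #|J|)).
      by rewrite ltr_pM2r ?exprn_gt0.
    by rewrite ler_pM2l ?expR_gt0// ler_weXn2l// ler1n.
  rewrite expRM_natr exprM -exprMn natrX ME natrX -exprM mulnC.
  apply: (@le_trans _ _ (B%:R ^+ n)).
    by rewrite lerXn2r ?nnegrE ?ltW// mulr_gt0 ?expR_gt0 ?exprn_gt0.
  (* The extra 1 in the exponent absorbs the remainder: n < q (n / q + 1). *)
  by rewrite ler_weXn2l ?ler1n// ltnW// ltn_ceil.
have [beta [fb ob bP]] := exists_small_cover cf fF szlt.
apply: le_trans ob; apply: cover_D_le => // V bV.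
have [[x Vx] Vf] := bP V bV.
apply: cover_join_refines => i; apply: cover_join_refines => j.
(* The bump function l equals 1 at the orbit point of x, so f < 1 fails on V; the other alternative
   puts V inside the preimage of U. *)
have [_ _ /(_ (iter j (T i) (tau pi i x)))[l u1] /(_ l)[U aU uU]] := uP i.
exists (iter j (T 0%N) @^-1` (tau pi i @^-1` U)).
  by exists (tau pi i @^-1` U) => //; exists U.
have [/(_ x Vx)|Vpos] := Vf (Tagged _ (j, l)).
  by rewrite /f /= u1 ltxx.
by move=> y Vy /=; rewrite (tau_iter piT)//; apply: uU; exact: Vpos.
Qed.

Lemma weighted_mdim_eq0 : weighted_mdim T pi a = 0%E.
Proof.
apply/eqP; rewrite eq_le; apply/andP; split; last first.
  (* The trivial covers provide one term of the supremum, and every limit superior here is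
     nonnegative. *)
  apply: le_trans (ereal_sup_ubound _); last first.
    exists (fun i => [set setT]) => // i; split.
    - exact: finite_set1.
    - by move=> _ ->; exact: openT.
    - by rewrite bigcup_set1.
  by apply: limn_esup_ge0 => n; rewrite lee_fin mulr_ge0 ?invr_ge0 ?cover_D_ge0.
apply: ge_ereal_sup => _ [alpha fa <-]; apply/lee_addgt0Pr => e e0.
rewrite add0e; apply: limn_esup_le_near.
(* [Num.bound] exceeds 1/e, so 1/q <= e; the successor makes q visibly positive. *)
pose q := (Num.bound e^-1).+1.
have qe : q%:R^-1 <= e.
  rewrite -[leRHS]invrK lef_pV2 ?posrE ?invr_gt0// /q -natr1.
  by rewrite ltW// ltr_wpDr// archi_boundP// invr_ge0 ltW.
have := cover_D_weighted_join_near (isT : (0 < q)%N) fa.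
apply: filterS2 (nbhs_infty_gt 0%N) => n n0 Dn.
rewrite lee_fin; apply: le_trans qe.
rewrite mulrC ler_pdivrMr ?ltr0n//; apply: le_trans Dn _.
by rewrite mulrC ler_pdivlMr ?ltr0n// -natrM ler_nat leq_divM.
Qed.
End mean_dimension.

Theorem mainTheorem3 (R : realType) (k : nat) (X : nat -> metricType R)
    (T : forall i, X i -> X i) (pi : forall i, X i -> X i.+1)
    (a : 'I_k -> R)
    (hk : (2 <= k)%N)
    (hX : forall i, (i < k)%N -> compact [set: X i])
    (hT : forall i, (i < k)%N -> continuous (T i))
    (hpi : forall i, (i.+1 < k)%N -> continuous (pi i))
    (hpiT : forall i, (i.+1 < k)%N -> pi i \o T i = T i.+1 \o pi i)
    (ha0 : forall i : 'I_k, i = 0%N :> nat -> 0 < a i)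
    (ha : forall i : 'I_k, (0 < i)%N -> 0 <= a i)
    (hent : weighted_entropy T pi a \is a fin_num) :
  weighted_mdim T pi a = 0%E.
Proof.
apply: weighted_mdim_eq0 => // i.
by have [i0|] := posnP i; [exact/ltW/ha0 | exact: ha].
Qed.
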